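(* Let $\sum_{n=0}^\infty c_n w_n$ be a Walsh series with real coefficients $c_n$, all of whose partial sums are positive, i.e. for every integer $N\ge 0$ and every $x\in\mathbb{D}$, $$\sum_{n=0}^{N} c_n w_n(x)\ \ge\ 0 .$$ Then $c_n\to 0$ as $n\to\infty$.
   Context: $\mathbb{D}=\{-1,1\}^{\mathbb{N}^*}$ with $\mathbb{N}^*=\{1,2,3,\ldots\}$, regarded as a multiplicative group (with product topology); it serves as the model of $[0,1]$ on which Walsh functions are defined. The coordinate functions $r_1,r_2,\ldots$ on $\mathbb{D}$ are the Rademacher functions: $r_j(x)=x_j$ for $x=(x_1,x_2,\ldots)\in\mathbb{D}$. For an integer $n\ge 0$ with binary expansion $n=\sum_{j\ge1}\alpha_j 2^{j-1}$, $\alpha_j\in\{0,1\}$ (finitely many nonzero), the Walsh function $w_n$ is $w_n=\prod_{j\ge 1} r_j^{\alpha_j}$. Thus $w_0=1$, $w_1=r_1$, $w_2=r_2$, $w_3=r_1r_2$, $w_4=r_3$, etc. A Walsh series is a formal series $\sum_{n=0}^\infty c_n w_n$. ''Positive'' means $\ge 0$. *)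

(* Defs.v *)
From mathcomp Require Import all_boot all_order all_algebra.
From mathcomp Require Import all_classical all_reals all_analysis.

Set Implicit Arguments.
Unset Strict Implicit.
Unset Printing Implicit Defensive.

Import Order.TTheory GRing.Theory Num.Theory.
Import numFieldNormedType.Exports.

Local Open Scope classical_set_scope.
Local Open Scope ring_scope.

(* The coordinates of a point are numbered x_1, x_2, ... in the mathematics;
   x_j is the term of index j - 1 of the sequence x : nat -> R. *)
Definition dyadic_group (R : realType) : set (nat -> R) :=
  [set x | forall i : nat, x i = -1 \/ x i = 1].
Arguments dyadic_group R : clear implicits.

(* Meaningful for j >= 1 only. *)
Definition rademacher (R : realType) (j : nat) (x : nat -> R) : R := x j.-1.

(* The coefficient alpha_j of 2 ^ (j - 1) in the binary expansion of n,
   for j >= 1. *)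
Definition binary_digit (n j : nat) : nat := odd (n %/ 2 ^ j.-1).

(* The product over all j >= 1 may stop at j = n, since alpha_j = 0
   for j > n (then n < 2 ^ (j - 1)). *)
Definition walsh (R : realType) (n : nat) (x : nat -> R) : R :=
  \prod_(1 <= j < n.+1) rademacher j x ^+ binary_digit n j.

(* Main.v *)
Require Import Defs.
From mathcomp Require Import all_boot all_order all_algebra.
From mathcomp Require Import all_classical all_reals all_analysis.
From mathcomp Require Import zify ring lra.

Import Order.TTheory GRing.Theory Num.Theory.
Import numFieldNormedType.Exports.

Local Open Scope classical_set_scope.
Local Open Scope ring_scope.

(** Write S_N for the sum of the first N terms, f_a for S_(2^a), E_t for the
conditional expectation given the first t coordinates, and q_t for the mean of
the square root of f_t. The f_a form a positive martingale with mean c_0, and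
for n = 2^a + m with m < 2^a the coefficient c_n is the mean of w_n f_(a+1).
For t <= a, two bounds hold for the conditional mean G_t = E_t(w_n f_(a+1)).

The first one is where positivity of all partial sums enters
([cexp_wal_le_cellinf]). Up to sign, G_t is S_(p + 2^t) - S_p, where p is n with
its t lowest binary digits cleared. For 2^a <= N <= 2^(a+1), averaging S_N over
the coordinate of index a gives f_a, so 0 <= S_N <= 2 f_a pointwise. As the
absolute value of G_t depends on the first t coordinates only, it is at most
twice the infimum of f_a over each cell of order t. So the oscillating
functions w_n f_(a+1) do not see the singular part of the measure defined by
the martingale.

The second one ([cexp_wal_le_sqrt]) is a Riemann-Lebesgue lemma for the
absolutely continuous part. As E_t w_n = 0, one may replace f_(a+1) by
f_(a+1) - f_t, which is small in mean when f_t is bounded and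
q_t - q_(a+1) is small.

In [coef_le] the second bound serves on the cells where f_t <= r^2 and the first
one on the others. Those others have measure at most c_0 / r^2, but the cell
infima must be uniformly integrable for this to help. They are: the mean of the
cell infimum of f_a over the cells of order t increases with t and decreases
with a, so that for a suitable s it is, for t >= s and a large, close to its
value for s ([double_stable]), and the infima for s are at most the maximum of
f_s. Since q_t also decreases to a limit ([antitone_stable]), every term of the
bound can be made small. *)

(** * Averaging over coordinates *)

(** Points of the dyadic group are coded by sequences of booleans, [false]
standing for 1 and [true] for -1, so that no membership condition has to be
carried along. *)
Definition upd (j : nat) (b : bool) (w : nat -> bool) : nat -> bool :=
  fun i => if i == j then b else w i.

Definition agree (t : nat) (w w' : nat -> bool) := forall i, (i < t)%N -> w i = w' i.

Definition depends (R : realType) (t : nat) (F : (nat -> bool) -> R) :=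
  forall w w', agree t w w' -> F w = F w'.

Definition avg (R : realType) (j : nat) (F : (nat -> bool) -> R) :=
  fun w => (F (upd j false w) + F (upd j true w)) / 2.

(** Averages over the coordinates of index [s], ..., [s + k - 1]. For a function
of the first [s + k] coordinates this is the conditional expectation given the
first [s] ones. *)
Fixpoint cexp (R : realType) (s k : nat) (F : (nat -> bool) -> R) :=
  if k is k'.+1 then cexp R s k' (avg R (s + k') F) else F.

Arguments depends {R}.
Arguments avg {R}.
Arguments cexp {R}.

Lemma agree_upd t j b w : (t <= j)%N -> agree t w (upd j b w).
Proof. by move=> tj i it; rewrite /upd ifN //; lia. Qed.

Lemma upd_id j w : upd j (w j) w = w.
Proof. by apply/funext => i; rewrite /upd; case: eqP => [->|]. Qed.

Lemma depends_upd {R : realType} t j b (F : (nat -> bool) -> R) w :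
  (t <= j)%N -> depends t F -> F (upd j b w) = F w.
Proof. by move=> tj dF; apply/esym/dF/agree_upd. Qed.

Lemma dependsM {R : realType} t (F G : (nat -> bool) -> R) :
  depends t F -> depends t G -> depends t (fun w => F w * G w).
Proof. by move=> dF dG w w' ww'; rewrite (dF _ _ ww') (dG _ _ ww'). Qed.

(** The tower property. *)
Lemma cexp_cat {R : realType} s k l (F : (nat -> bool) -> R) :
  cexp s (k + l) F = cexp s k (cexp (s + k) l F).
Proof. by elim: l F => [|l IH] F; rewrite ?addn0 ?addnS //= IH addnA. Qed.

Lemma cexp_lin {R : realType} s k (a b : R) F G :
  cexp s k (fun w => a * F w + b * G w) =
  (fun w => a * cexp s k F w + b * cexp s k G w).
Proof.
elim: k F G => // k IH F G /=; rewrite -IH; congr cexp.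
by apply/funext => w; rewrite /avg; field.
Qed.

Lemma cexp_cst {R : realType} s k (a : R) : cexp s k (fun=> a) = (fun=> a).
Proof.
elim: k => // k IH /=; rewrite -[RHS]IH; congr cexp.
by apply/funext => w; rewrite /avg; field.
Qed.

Lemma cexpD {R : realType} s k (F G : (nat -> bool) -> R) :
  cexp s k (fun w => F w + G w) = (fun w => cexp s k F w + cexp s k G w).
Proof.
have := cexp_lin s k 1 1 F G.
under eq_fun do rewrite !mul1r.
by move=> ->; apply/funext => w; rewrite !mul1r.
Qed.

Lemma cexpB {R : realType} s k (F G : (nat -> bool) -> R) :
  cexp s k (fun w => F w - G w) = (fun w => cexp s k F w - cexp s k G w).
Proof.
have := cexp_lin s k 1 (-1) F G.
under eq_fun do rewrite !mul1r mulN1r.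
by move=> ->; apply/funext => w; rewrite !mul1r mulN1r.
Qed.

Lemma cexpMl {R : realType} s k (G F : (nat -> bool) -> R) : depends s G ->
  cexp s k (fun w => G w * F w) = (fun w => G w * cexp s k F w).
Proof.
move=> dG; elim: k F => // k IH F /=; rewrite -IH; congr cexp.
apply/funext => w; rewrite /avg !(depends_upd _ _ _ _ _ _ dG) ?leq_addr //.
by field.
Qed.

Lemma cexpZ {R : realType} s k (a : R) F :
  cexp s k (fun w => a * F w) = (fun w => a * cexp s k F w).
Proof. exact: (cexpMl s k (fun=> a)). Qed.

Lemma cexp_id {R : realType} s k (F : (nat -> bool) -> R) :
  depends s F -> cexp s k F = F.
Proof.
move=> dF; elim: k => // k IH /=; rewrite -[RHS]IH; congr cexp.
apply/funext => w; rewrite /avg !(depends_upd _ _ _ _ _ _ dF) ?leq_addr //.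
by field.
Qed.

Lemma le_cexp {R : realType} s k (F G : (nat -> bool) -> R) :
  (forall w, F w <= G w) -> forall w, cexp s k F w <= cexp s k G w.
Proof.
elim: k F G => // k IH F G FG /=; apply: IH => w.
by rewrite /avg ler_pM2r ?invr_gt0 // lerD.
Qed.

Lemma ler_norm_cexp {R : realType} s k (F : (nat -> bool) -> R) w :
  `|cexp s k F w| <= cexp s k (fun w => `|F w|) w.
Proof.
rewrite ler_norml -mulN1r -[X in X <= _](congr1 (@^~ w) (cexpZ s k (-1) _)).
apply/andP; split; apply: le_cexp => w'; last exact: ler_norm.
by rewrite mulN1r lerNl -normrN ler_norm.
Qed.

Lemma cexp_ge0 {R : realType} s k (F : (nat -> bool) -> R) :
  (forall w, 0 <= F w) -> forall w, 0 <= cexp s k F w.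
Proof. by move=> F0 w; rewrite -[leLHS](congr1 (@^~ w) (cexp_cst s k 0)) le_cexp. Qed.

(** * Walsh functions and their partial sums *)

Definition rad (R : realType) (i : nat) (w : nat -> bool) : R := (-1) ^+ w i.

Definition wal (R : realType) (n : nat) (w : nat -> bool) : R :=
  walsh n (fun i => rad R i w).

Definition psum (R : realType) (c : nat -> R) (N : nat) (w : nat -> bool) : R :=
  \sum_(0 <= n < N) c n * wal R n w.

Arguments rad {R}.
Arguments wal {R}.
Arguments psum {R}.

(** Any bound on the number of binary digits of [n] may replace the range of the
defining product, because the further digits vanish. *)
Lemma walE {R : realType} K n w : (n < 2 ^ K)%N ->
  wal n w = \prod_(0 <= i < K) (rad i w : R) ^+ odd (n %/ 2 ^ i).
Proof.
move=> nK; rewrite /wal /walsh big_add1 /=.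
have tail a b : (n < 2 ^ a)%N -> (a <= b)%N ->
    \prod_(0 <= i < b) (rad i w : R) ^+ odd (n %/ 2 ^ i) =
    \prod_(0 <= i < a) (rad i w : R) ^+ odd (n %/ 2 ^ i).
  move=> na ab; rewrite (big_cat_nat _ ab) //= [X in _ * X]big1_seq ?mulr1 //.
  move=> i; rewrite mem_index_iota => /andP[_ /andP[ai _]]; rewrite divn_small ?expr0 //.
  by rewrite (leq_trans na) // leq_exp2l.
have [Kn|nK'] := leqP K n; first exact: tail.
by rewrite [RHS](tail n K (@ltn_expl 2 n isT) (ltnW nK')).
Qed.

Lemma wal_top {R : realType} a m w : (m < 2 ^ a)%N ->
  wal (2 ^ a + m) w = rad a w * wal m w :> R.
Proof.
move=> ma; rewrite (walE a.+1); last by rewrite expnS; lia.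
rewrite (walE a m) // big_nat_recr //= mulrC; congr (_ * _).
  by rewrite divnDl // divnn expn_gt0 /= divn_small //= expr1.
rewrite !big_nat; apply: eq_bigr => i /andP[_ ia]; congr (_ ^+ _).
rewrite divnDl ?dvdn_exp2l 1?ltnW // oddD -expnB 1?ltnW //.
by rewrite oddX subn_eq0 leqNgt ia.
Qed.

Lemma wal0 {R : realType} w : wal 0 w = 1 :> R.
Proof. by rewrite (walE 0) // big_geq. Qed.

Lemma wal_depends {R : realType} a n : (n < 2 ^ a)%N -> depends a (@wal R n).
Proof.
move=> na w w' ww'; rewrite !(walE a) // !big_nat.
by apply: eq_bigr => i /andP[_ ia]; rewrite /rad ww'.
Qed.

Lemma normr_wal {R : realType} n w : `|wal n w : R| = 1.
Proof.
rewrite (walE n _ _ (@ltn_expl 2 n isT)) normr_prod big1 // => i _.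
by rewrite normrX normrX normrN1 !expr1n.
Qed.

(** The factors share no binary digit: [2 ^ t * i] only has digits from rank [t]
on, and [q] only below. The induction removes the top digit of [i]. *)
Lemma wal_mul_low {R : realType} t k i q w : (i < 2 ^ k)%N -> (q < 2 ^ t)%N ->
  wal (2 ^ t * i + q) w = wal (2 ^ t * i) w * wal q w :> R.
Proof.
move=> ik qt; elim: k i ik => [|k IH] i.
  by rewrite expn0 ltnS leqn0 => /eqP->; rewrite muln0 add0n wal0 mul1r.
have [ik _|ki ik] := ltnP i (2 ^ k); first exact: IH.
have [i' ei] : exists i', i = (2 ^ k + i')%N by exists (i - 2 ^ k)%N; lia.
have i'k : (i' < 2 ^ k)%N by move: ik; rewrite expnS; lia.
have b : (2 ^ t * i' + 2 ^ t <= 2 ^ (t + k))%N.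
  by rewrite -mulnSr expnD leq_mul2l i'k orbT.
by rewrite ei mulnDr -expnD -addnA !wal_top ?IH ?mulrA //; lia.
Qed.

Lemma psum_depends {R : realType} (c : nat -> R) a N :
  (N <= 2 ^ a)%N -> depends a (psum c N).
Proof.
move=> Na w w' ww'; rewrite /psum !big_nat; apply: eq_bigr => n /andP[_ nN].
by rewrite (wal_depends a n _ _ _ ww') // (leq_trans nN).
Qed.

Lemma psum_top {R : realType} (c : nat -> R) a M w : (M <= 2 ^ a)%N ->
  psum c (2 ^ a + M) w =
  psum c (2 ^ a) w + rad a w * psum (fun j => c (2 ^ a + j)%N) M w.
Proof.
move=> Ma; rewrite /psum (@big_cat_nat _ _ _ (2 ^ a)) ?leq_addr //=; congr (_ + _).
rewrite -{1}[(2 ^ a)%N]add0n big_addn addKn mulr_sumr !big_nat.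
apply: eq_bigr => j /andP[_ jM].
by rewrite addnC wal_top ?(leq_trans jM) // mulrCA.
Qed.

(** A block of consecutive terms of dyadic length, aligned on its length, is a
common factor of modulus 1 times a sum that only involves the first [t]
coordinates. *)
Lemma psum_block {R : realType} (c : nat -> R) t k i w : (i < 2 ^ k)%N ->
  wal (2 ^ t * i) w * psum (fun j => c (2 ^ t * i + j)%N) (2 ^ t) w =
  psum c (2 ^ t * i + 2 ^ t) w - psum c (2 ^ t * i) w.
Proof.
move=> ik; rewrite /psum.
rewrite (@big_cat_nat _ _ _ (2 ^ t * i) 0 (2 ^ t * i + 2 ^ t)) ?leq_addr //=.
rewrite addrAC subrr add0r mulr_sumr.
rewrite -[X in _ = \sum_(X <= _ < _) _]add0n big_addn addKn !big_nat.
apply: eq_bigr => j /andP[_ jt].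
by rewrite [(j + _)%N]addnC (wal_mul_low t k) // mulrCA.
Qed.

Lemma avg_top {R : realType} a (F G : (nat -> bool) -> R) :
  depends a F -> depends a G -> avg a (fun w => F w + rad a w * G w) = F.
Proof.
move=> dF dG; apply/funext => w; rewrite /avg.
rewrite !(depends_upd _ _ _ _ _ (leqnn a) dF) !(depends_upd _ _ _ _ _ (leqnn a) dG).
by rewrite /rad /upd eqxx /= expr0 expr1; field.
Qed.

Lemma avg_wal {R : realType} a m : (m < 2 ^ a)%N ->
  avg a (@wal R (2 ^ a + m)) = (fun=> 0).
Proof.
move=> ma; rewrite -[RHS](@avg_top R a (fun=> 0) (wal m)) //; last exact: wal_depends.
by congr avg; apply/funext => w; rewrite wal_top // add0r.
Qed.

(** Beyond its first [2 ^ a] terms, [psum c (2 ^ a + M)] has only multiples of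
the Rademacher function of index [a]. *)
Lemma avg_psum {R : realType} (c : nat -> R) a M : (M <= 2 ^ a)%N ->
  avg a (psum c (2 ^ a + M)) = psum c (2 ^ a).
Proof.
move=> Ma; rewrite -[RHS](avg_top a _ (psum (fun j => c (2 ^ a + j)%N) M)).
- by congr avg; apply/funext => w; rewrite psum_top.
- exact: psum_depends.
- exact: psum_depends.
Qed.

Lemma cexp_psum {R : realType} (c : nat -> R) t k :
  cexp t k (psum c (2 ^ (t + k))) = psum c (2 ^ t).
Proof.
elim: k => [|k IH]; first by rewrite addn0.
by rewrite /= addnS expnS mul2n -addnn avg_psum.
Qed.

(** Orthogonality in conditional form. Peeling off the top coordinate keeps
either the lower or the upper half of the sum, according to the top digit of
[i]; for [t = 0] a single coefficient remains. *)
Lemma cexp_wal_psum {R : realType} t k (c : nat -> R) i : (i < 2 ^ k)%N ->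
  cexp t k (fun w => wal (2 ^ t * i) w * psum c (2 ^ (t + k)) w) =
  psum (fun j => c (2 ^ t * i + j)%N) (2 ^ t).
Proof.
elim: k c i => [|k IH] c i.
  rewrite expn0 ltnS leqn0 => /eqP->; apply/funext => w.
  by rewrite /= muln0 wal0 mul1r addn0.
have e : (2 ^ (t + k.+1) = 2 ^ (t + k) + 2 ^ (t + k))%N.
  by rewrite addnS expnS mul2n addnn.
have lt_block l : (l < 2 ^ k)%N -> (2 ^ t * l < 2 ^ (t + k))%N.
  by rewrite expnD ltn_mul2l expn_gt0.
have [ik _|ki ik] := ltnP i (2 ^ k).
  rewrite -(IH c i ik) /=; congr cexp.
  have dw : depends (t + k) (@wal R (2 ^ t * i)) by apply/wal_depends/lt_block.
  rewrite -[RHS](avg_top (t + k) _ (fun w => wal (2 ^ t * i) w *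
    psum (fun j => c (2 ^ (t + k) + j)%N) (2 ^ (t + k)) w)).
  - congr avg; apply/funext => w; rewrite e psum_top //; ring.
  - by apply: dependsM => //; exact: psum_depends.
  - by apply: dependsM => //; exact: psum_depends.
have [i' ei] : exists i', i = (2 ^ k + i')%N by exists (i - 2 ^ k)%N; lia.
have i'k : (i' < 2 ^ k)%N by move: ik; rewrite expnS; lia.
have dw : depends (t + k) (@wal R (2 ^ t * i')) by apply/wal_depends/lt_block.
have -> : (fun j => c (2 ^ t * i + j)%N) =
    (fun j => (fun l => c (2 ^ (t + k) + l)%N) (2 ^ t * i' + j)%N).
  by apply/funext => j; rewrite ei mulnDr -expnD addnA.
rewrite -(IH (fun l => c (2 ^ (t + k) + l)%N) i' i'k) /=; congr cexp.
rewrite -[RHS](avg_top (t + k) _ (fun w => wal (2 ^ t * i') w *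
  psum c (2 ^ (t + k)) w)).
- congr avg; apply/funext => w.
  rewrite e psum_top // ei mulnDr -expnD wal_top ?lt_block //.
  have : rad (t + k) w * rad (t + k) w = 1 :> R by rewrite /rad -expr2 sqrr_sign.
  set r := rad _ _ => r2; rewrite mulrDr addrC; congr (_ + _); last by ring.
  by rewrite mulrACA r2 mul1r.
- by apply: dependsM => //; exact: psum_depends.
- by apply: dependsM => //; exact: psum_depends.
Qed.

(** * The dyadic martingale of a series with positive partial sums *)

Definition positive_psums (R : realType) (c : nat -> R) :=
  forall N w, 0 <= psum c N w.

Arguments positive_psums {R}.

(** [psum c (2 ^ a) w] is the average of the values of [psum c N] at the two
points that differ from [w] at most in the coordinate [a]. Both values are
nonnegative, and one of them is [psum c N w]. *)
Lemma psum_le_twice {R : realType} (c : nat -> R) a N w : positive_psums c ->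
  (2 ^ a <= N <= 2 ^ a.+1)%N -> psum c N w <= 2 * psum c (2 ^ a) w.
Proof.
move=> c0 /andP[aN Na].
have [M eN] : exists M, N = (2 ^ a + M)%N by exists (N - 2 ^ a)%N; lia.
have Ma : (M <= 2 ^ a)%N by move: Na; rewrite expnS; lia.
rewrite -(avg_psum c a M Ma) -eN /avg mulrC divfK ?pnatr_eq0 //.
have := c0 N (upd a false w); have := c0 N (upd a true w).
by case: (w a) (upd_id a w) => {3}<-; lra.
Qed.

Lemma cexp_psum_mean {R : realType} (c : nat -> R) t w :
  cexp 0 t (psum c (2 ^ t)) w = c 0%N.
Proof. by rewrite -[t in (2 ^ t)%N]add0n cexp_psum /psum big_nat1 wal0 mulr1. Qed.

(** The cell of order [t] of [w] consists of the points with the same first [t]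
coordinates as [w]. *)
Definition cellinf (R : realType) (t : nat) (F : (nat -> bool) -> R) (w : nat -> bool) :=
  inf [set F w' | w' in agree t w].

Arguments cellinf {R}.

Lemma cellinf_le {R : realType} t (F : (nat -> bool) -> R) w w' :
  (forall v, 0 <= F v) -> agree t w w' -> cellinf t F w <= F w'.
Proof.
move=> F0 ww'; apply: ge_inf; last by exists w'.
by exists 0 => _ [v _ <-].
Qed.

Lemma le_cellinf {R : realType} t (F : (nat -> bool) -> R) w a :
  (forall w', agree t w w' -> a <= F w') -> a <= cellinf t F w.
Proof.
move=> aF; apply: lb_le_inf; first by exists (F w), w.
by move=> _ [v wv <-]; exact: aF.
Qed.

Lemma cellinf_ge0 {R : realType} t (F : (nat -> bool) -> R) w :
  (forall v, 0 <= F v) -> 0 <= cellinf t F w.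
Proof. by move=> F0; apply: le_cellinf. Qed.

Lemma cellinf_depends {R : realType} t (F : (nat -> bool) -> R) :
  depends t (cellinf t F).
Proof.
move=> w w' ww'; congr inf; apply/seteqP; split=> _ [v av <-]; exists v => // i it.
  by rewrite -ww' // av.
by rewrite ww' // av.
Qed.

Lemma cellinf_mono {R : realType} s t (F : (nat -> bool) -> R) w :
  (forall v, 0 <= F v) -> (s <= t)%N -> cellinf s F w <= cellinf t F w.
Proof.
move=> F0 st; apply: le_cellinf => w' ww'; apply: cellinf_le => // i /leq_trans/(_ st).
exact: ww'.
Qed.

Lemma cellinf_avg {R : realType} t a (F : (nat -> bool) -> R) w :
  (forall v, 0 <= F v) -> (t <= a)%N -> cellinf t F w <= cellinf t (avg a F) w.
Proof.
move=> F0 ta; apply: le_cellinf => w' ww'; rewrite ler_pdivlMr // mulrDr mulr1.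
by apply: lerD; apply: cellinf_le => // i it;
    rewrite (ww' i it); exact: (agree_upd t).
Qed.

Lemma cellinf_le_cexp {R : realType} t k (F : (nat -> bool) -> R) w :
  (forall v, 0 <= F v) -> cellinf t F w <= cexp t k F w.
Proof.
move=> F0; rewrite -[leLHS](congr1 (@^~ w) (cexp_id t k _ (cellinf_depends t F))).
by apply: le_cexp => v; exact: cellinf_le.
Qed.

(** The block is, up to sign, the difference of two partial sums, each of which
lies between 0 and [2 * psum c (2 ^ (t + k))] at every point. The left-hand side
is constant on cells of order [t], so one may take the infimum over the cell. *)
Lemma block_le_cellinf {R : realType} (c : nat -> R) t k i w :
  positive_psums c -> (2 ^ k <= i < 2 ^ k.+1)%N ->
  `|psum (fun j => c (2 ^ t * i + j)%N) (2 ^ t) w|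
    <= 2 * cellinf t (psum c (2 ^ (t + k))) w.
Proof.
move=> c0 /andP[ki ik]; rewrite mulrC -ler_pdivrMr //.
apply: le_cellinf => w' ww'; rewrite ler_pdivrMr //.
rewrite (psum_depends _ t (2 ^ t) _ _ _ ww') //.
rewrite -[leLHS]mul1r -{1}(normr_wal (2 ^ t * i) w') -normrM (psum_block _ _ k.+1) //.
have lo : (2 ^ (t + k) <= 2 ^ t * i)%N by rewrite expnD leq_mul2l ki orbT.
have hi : (2 ^ t * i + 2 ^ t <= 2 ^ (t + k).+1)%N.
  by rewrite -mulnSr -addnS expnD leq_mul2l ik orbT.
have h1 : psum c (2 ^ t * i + 2 ^ t) w' <= 2 * psum c (2 ^ (t + k)) w'.
  by apply: psum_le_twice => //; lia.
have h2 : psum c (2 ^ t * i) w' <= 2 * psum c (2 ^ (t + k)) w'.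
  by apply: psum_le_twice => //; lia.
have := c0 (2 ^ t * i)%N w'; have := c0 (2 ^ t * i + 2 ^ t)%N w'.
by rewrite ler_norml; lra.
Qed.

(** The low digits of the index contribute a factor of modulus 1, which is
constant on cells, and orthogonality turns what remains into a block. *)
Lemma cexp_wal_le_cellinf {R : realType} (c : nat -> R) t k m w :
  positive_psums c -> (m < 2 ^ (t + k))%N ->
  `|cexp t k.+1 (fun v => wal (2 ^ (t + k) + m) v * psum c (2 ^ (t + k.+1)) v) w|
    <= 2 * cellinf t (psum c (2 ^ (t + k))) w.
Proof.
move=> c0 mt; set n := (_ + m)%N.
pose i := (n %/ 2 ^ t)%N; pose q := (n %% 2 ^ t)%N.
have en : n = (2 ^ t * i + q)%N by rewrite mulnC -divn_eq.
have qt : (q < 2 ^ t)%N by rewrite ltn_mod expn_gt0.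
have ki : (2 ^ k <= i < 2 ^ k.+1)%N.
  rewrite leq_divRL ?expn_gt0 // ltn_divLR ?expn_gt0 //.
  by rewrite expnS -mulnA -expnD [(k + t)%N]addnC /n; lia.
have -> : (fun v => wal n v * psum c (2 ^ (t + k.+1)) v) =
    (fun v => wal q v * (wal (2 ^ t * i) v * psum c (2 ^ (t + k.+1)) v)).
  apply/funext => v; rewrite en (wal_mul_low t k.+1) //; last by case/andP: ki.
  by rewrite mulrA [wal q v * _]mulrC.
rewrite cexpMl; last exact: wal_depends.
rewrite cexp_wal_psum; last by case/andP: ki.
by rewrite normrM normr_wal mul1r; exact: block_le_cellinf.
Qed.

Lemma coef_mean {R : realType} (c : nat -> R) t n w : (n < 2 ^ t)%N ->
  c n = cexp 0 t (fun v => wal n v * psum c (2 ^ t) v) w.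
Proof.
move=> nt; have := cexp_wal_psum 0 t c n nt; rewrite expn0 mul1n add0n => ->.
by rewrite /psum big_nat1 wal0 addn0 mulr1.
Qed.

Lemma cexp_wal {R : realType} t k m : (m < 2 ^ (t + k))%N ->
  cexp t k.+1 (@wal R (2 ^ (t + k) + m)) = (fun=> 0).
Proof. by move=> mt; rewrite /= avg_wal // cexp_cst. Qed.

(** * Square roots and the absolutely continuous part *)

Lemma sqrt_midpoint {R : realType} (u v : R) : 0 <= u -> 0 <= v ->
  (Num.sqrt u + Num.sqrt v) / 2 <= Num.sqrt ((u + v) / 2).
Proof.
move=> u0 v0; rewrite -[leLHS]ger0_norm; last by rewrite divr_ge0 ?addr_ge0 ?sqrtr_ge0.
rewrite -sqrtr_sqr ler_sqrt ?divr_ge0 ?addr_ge0 //.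
have := sqr_sqrtr u0; have := sqr_sqrtr v0.
set a := Num.sqrt u; set b := Num.sqrt v => <- <-.
by have := sqr_ge0 (a - b); nra.
Qed.

(** The conditional form of Jensen's inequality for the square root, along the
martingale of the dyadic partial sums. *)
Lemma cexp_sqrt_psum {R : realType} (c : nat -> R) t k w : positive_psums c ->
  cexp t k (fun v => Num.sqrt (psum c (2 ^ (t + k)) v)) w
    <= Num.sqrt (psum c (2 ^ t) w).
Proof.
move=> c0; elim: k => [|k IH]; first by rewrite addn0.
apply: le_trans IH => /=; apply: le_cexp => v.
rewrite addnS expnS mul2n -addnn -[in leRHS](avg_psum c _ (2 ^ (t + k))) //.
exact: sqrt_midpoint.
Qed.

(** With [a], [b] the square roots of [f], [F], write [f - F] as
[(a - b) * (a + b)] and apply the arithmetic-geometric inequality with weight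
[l]. The expression is arranged so that its first term has conditional mean 0
along a martingale, and its second one a multiple of the defect in Jensen's
inequality. *)
Lemma norm_sub_sqrt {R : realType} (f F l : R) : 0 <= f -> 0 <= F -> 0 < l ->
  `|f - F| <= l / 2 * (f - F) + l * (Num.sqrt F * (Num.sqrt F - Num.sqrt f))
               + l^-1 * (f + F).
Proof.
move=> f0 F0 l0.
have := sqr_sqrtr f0; have := sqr_sqrtr F0.
have := sqrtr_ge0 f; have := sqrtr_ge0 F.
set a := Num.sqrt f; set b := Num.sqrt F => b0 a0 <- <-.
have il : l * l^-1 = 1 by rewrite divff // gt_eqF.
have il0 : 0 < l^-1 by rewrite invr_gt0.
set p := l^-1 in il il0 *.
have key : `|a - b| * (a + b) <= l / 2 * (a - b) ^+ 2 + p / 2 * (a + b) ^+ 2.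
  rewrite -[(a - b) ^+ 2]real_normK ?num_real //; set x := `|_|.
  have : 0 <= p * (l * x - (a + b)) ^+ 2 by rewrite mulr_ge0 ?sqr_ge0 // ltW.
  have -> : p * (l * x - (a + b)) ^+ 2 = (l * p) * l * x ^+ 2
     - 2 * (l * p) * x * (a + b) + p * (a + b) ^+ 2 by ring.
  by rewrite il; lra.
rewrite subr_sqr normrM [`|a + b|]ger0_norm ?addr_ge0 //; apply: le_trans key _.
have : 0 <= p * (a - b) ^+ 2 by rewrite mulr_ge0 ?sqr_ge0 // ltW.
by lra.
Qed.

(** The Walsh function has conditional mean 0, so the martingale increment
[psum c (2 ^ (t + k.+1)) - psum c (2 ^ t)] may replace the partial sum; its size
is controlled by the defect in Jensen's inequality for the square root. *)
Lemma cexp_wal_le_sqrt {R : realType} (c : nat -> R) t k m w l :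
  positive_psums c -> (m < 2 ^ (t + k))%N -> 0 < l ->
  `|cexp t k.+1 (fun v => wal (2 ^ (t + k) + m) v * psum c (2 ^ (t + k.+1)) v) w|
  <= l * (Num.sqrt (psum c (2 ^ t) w) * (Num.sqrt (psum c (2 ^ t) w)
            - cexp t k.+1 (fun v => Num.sqrt (psum c (2 ^ (t + k.+1)) v)) w))
     + 2 / l * psum c (2 ^ t) w.
Proof.
move=> c0 mt l0; set n := (_ + m)%N.
set F := psum c (2 ^ t); set f := psum c (2 ^ (t + k.+1)).
have dF : depends t F by exact: psum_depends.
have dS : depends t (fun v => Num.sqrt (F v)) by move=> v v' vv'; rewrite (dF _ _ vv').
have Ef : cexp t k.+1 f = F by exact: cexp_psum.
have EF : cexp t k.+1 F = F by exact: cexp_id.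
have ES : cexp t k.+1 (fun v => Num.sqrt (F v)) = (fun v => Num.sqrt (F v)).
  exact: cexp_id.
have -> : cexp t k.+1 (fun v => wal n v * f v) w =
    cexp t k.+1 (fun v => wal n v * (f v - F v)) w.
  have -> : (fun v => wal n v * f v) =
      (fun v => wal n v * (f v - F v) + F v * wal n v).
    by apply/funext => v; ring.
  by rewrite cexpD [X in _ + X w]cexpMl // cexp_wal // mulr0 addr0.
apply: le_trans (ler_norm_cexp _ _ _ _) _.
apply: (@le_trans _ _ (cexp t k.+1 (fun v => l / 2 * (f v - F v)
    + l * (Num.sqrt (F v) * (Num.sqrt (F v) - Num.sqrt (f v)))
    + l^-1 * (f v + F v)) w)).
  apply: le_cexp => v; rewrite normrM normr_wal mul1r.
  by apply: norm_sub_sqrt => //; exact: c0.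
rewrite !cexpD !cexpZ cexpMl // !cexpB cexpD Ef EF ES subrr mulr0 add0r.
by rewrite lerD2l; lra.
Qed.

(** * Quantities that stabilise *)

(** The base point at which functions averaged over all their coordinates, hence
constant, are evaluated. *)
Definition w0 : nat -> bool := fun=> false.

Definition mean_sqrt (R : realType) (c : nat -> R) (t : nat) : R :=
  cexp 0 t (fun v => Num.sqrt (psum c (2 ^ t) v)) w0.

Definition mean_cellinf (R : realType) (c : nat -> R) (t a : nat) : R :=
  cexp 0 t (cellinf t (psum c (2 ^ a))) w0.

Arguments mean_sqrt {R}.
Arguments mean_cellinf {R}.

Lemma mean_sqrt_ge0 {R : realType} (c : nat -> R) t : 0 <= mean_sqrt c t.
Proof. by apply: cexp_ge0 => v; exact: sqrtr_ge0. Qed.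

Lemma mean_sqrt_anti {R : realType} (c : nat -> R) t u : positive_psums c ->
  (t <= u)%N -> mean_sqrt c u <= mean_sqrt c t.
Proof.
move=> c0 /subnKC <-; rewrite /mean_sqrt cexp_cat.
by apply: le_cexp => v; rewrite add0n; exact: cexp_sqrt_psum.
Qed.

Lemma mean_cellinf_ge0 {R : realType} (c : nat -> R) t a : positive_psums c ->
  0 <= mean_cellinf c t a.
Proof. by move=> c0; apply: cexp_ge0 => v; apply: cellinf_ge0 => v'; exact: c0. Qed.

Lemma mean_cellinf_diag {R : realType} (c : nat -> R) t : positive_psums c ->
  mean_cellinf c t t <= c 0%N.
Proof.
move=> c0; rewrite -(cexp_psum_mean c t w0).
by apply: le_cexp => v; apply: cellinf_le => // v'; exact: c0.
Qed.

Lemma mean_cellinfE {R : realType} (c : nat -> R) s t a : (s <= t)%N ->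
  mean_cellinf c s a = cexp 0 t (cellinf s (psum c (2 ^ a))) w0.
Proof.
by move=> /subnKC <-; rewrite cexp_cat (cexp_id s _ _ (cellinf_depends s _)).
Qed.

Lemma mean_cellinf_mono {R : realType} (c : nat -> R) s t a : positive_psums c ->
  (s <= t)%N -> mean_cellinf c s a <= mean_cellinf c t a.
Proof.
move=> c0 st; rewrite (mean_cellinfE c s t) //.
by apply: le_cexp => v; apply: cellinf_mono => // v'; exact: c0.
Qed.

(** A value of [psum c (2 ^ a)] is the average of two values of
[psum c (2 ^ a.+1)] in the same cell, which therefore has a smaller infimum. *)
Lemma mean_cellinf_anti {R : realType} (c : nat -> R) t a b : positive_psums c ->
  (t <= a)%N -> (a <= b)%N -> mean_cellinf c t b <= mean_cellinf c t a.
Proof.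
move=> c0 ta /subnKC <-; elim: (b - a)%N => [|k IH]; first by rewrite addn0.
apply: le_trans IH; apply: le_cexp => v.
rewrite addnS -(avg_psum c (a + k) (2 ^ (a + k))) // addnn -mul2n -expnS.
by apply: cellinf_avg; [exact: c0 | rewrite (leq_trans ta) ?leq_addr].
Qed.

Lemma antitone_stable {R : realType} (u : nat -> R) (e : R) : 0 < e ->
  (forall n, 0 <= u n) -> (forall m n, (m <= n)%N -> u n <= u m) ->
  exists n0, forall m n, (n0 <= m)%N -> u m <= u n + e.
Proof.
move=> e0 u0 um.
have lb : has_lbound (range u) by exists 0 => _ [n _ <-].
have hi : has_inf (range u) by split=> //; exists (u 0%N), 0%N.
have [_ [n0 _ <-] h] := inf_adherent e0 hi.
exists n0 => m n n0m; apply: (le_trans (um _ _ n0m)); apply: (le_trans (ltW h)).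
by rewrite lerD2r; apply: ge_inf => //; exists n.
Qed.

(** The limits of [u t] at infinity increase with [t] up to a supremum; [s] is
such that the limit of [u s] is within [e / 2] of it. *)
Lemma double_stable {R : realType} (u : nat -> nat -> R) (C e : R) : 0 < e ->
  (forall t a, 0 <= u t a) -> (forall t, u t t <= C) ->
  (forall s t a, (s <= t)%N -> u s a <= u t a) ->
  (forall t a b, (t <= a)%N -> (a <= b)%N -> u t b <= u t a) ->
  exists s, forall t, exists a0, forall a,
    (s <= t)%N -> (a0 <= a)%N -> u t a <= u s a + e.
Proof.
move=> e0 u0 uC um ua.
pose l t := inf [set u t a | a in [set a | (t <= a)%N]].
have lb t : has_lbound [set u t a | a in [set a | (t <= a)%N]].
  by exists 0 => _ [n _ <-].
have l_le t a : (t <= a)%N -> l t <= u t a by move=> ta; apply: ge_inf => //; exists a.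
have hs : has_sup (range l).
  split; first by exists (l 0%N), 0%N.
  by exists C => _ [t _ <-]; apply: le_trans (uC t); exact: l_le.
have e20 : 0 < e / 2 by rewrite divr_gt0.
have [_ [s _ <-] hl] := sup_adherent e20 hs.
exists s => t.
have hi : has_inf [set u t a | a in [set a | (t <= a)%N]].
  by split=> //; exists (u t t), t => /=.
have [_ [a0 /= ta0 <-] ha] := inf_adherent e20 hi.
exists a0 => a st aa0.
have h1 := ua _ _ _ ta0 aa0.
have h2 : l t <= sup (range l) by apply: ub_le_sup; [case: hs | exists t].
have h3 := l_le s a (leq_trans st (leq_trans ta0 aa0)).
by rewrite -/(l t) in ha; lra.
Qed.

(** * The coefficients *)

(** The bound is proved cell by cell of order [t], then averaged. Where
[psum c (2 ^ t) <= r ^+ 2] it follows from the square root estimate. Elsewhere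
the cell infimum of order [t] is at most its excess over the one of order [s]
plus [K], and [K <= K / r ^+ 2 * psum c (2 ^ t)] there. *)
Lemma coef_le {R : realType} (c : nat -> R) s t k m (K l r : R) :
  positive_psums c -> (s <= t)%N -> (m < 2 ^ (t + k))%N -> 0 < l -> 0 < r ->
  0 <= K -> (forall w, psum c (2 ^ s) w <= K) ->
  `|c (2 ^ (t + k) + m)%N| <=
    l * r * (mean_sqrt c t - mean_sqrt c (t + k.+1))
    + (2 / l + 2 * K / r ^+ 2) * c 0%N
    + 2 * (mean_cellinf c t (t + k) - mean_cellinf c s (t + k)).
Proof.
move=> c0 st mt l0 r0 K0 fK; set n := (_ + m)%N.
have nt : (n < 2 ^ (t + k.+1))%N by rewrite addnS expnS /n; lia.
rewrite (coef_mean c (t + k.+1) n w0 nt) cexp_cat add0n.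
apply: le_trans (ler_norm_cexp _ _ _ _) _.
set F := psum c (2 ^ t); set f := psum c (2 ^ (t + k.+1)).
set mut := cellinf t (psum c (2 ^ (t + k))).
set mus := cellinf s (psum c (2 ^ (t + k))).
pose E v := cexp t k.+1 (fun v => Num.sqrt (f v)) v.
rewrite /mean_sqrt cexp_cat add0n -/f -(cexp_psum_mean c t w0) -/F.
rewrite (mean_cellinfE c s t) // /mean_cellinf -/mut -/mus.
apply: (@le_trans _ _ (cexp 0 t (fun v => l * r * (Num.sqrt (F v) - E v)
  + (2 / l + 2 * K / r ^+ 2) * F v + 2 * (mut v - mus v)) w0)); last first.
  by rewrite !cexpD !cexpZ !cexpB.
apply: le_cexp => v.
have jensen : E v <= Num.sqrt (F v) by exact: cexp_sqrt_psum.
have mono : mus v <= mut v by apply: cellinf_mono => // v'; exact: c0.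
have F0 : 0 <= F v by exact: c0.
have l20 : 0 < 2 / l by rewrite divr_gt0.
have Kr : 0 <= 2 * K / r ^+ 2 by rewrite divr_ge0 ?mulr_ge0 ?exprn_ge0 // ltW.
have A0 : 0 <= l * r * (Num.sqrt (F v) - E v).
  by rewrite mulr_ge0 ?subr_ge0 // mulr_ge0 // ltW.
have B0 : 0 <= 2 / l * F v by rewrite mulr_ge0 // ltW.
have C0 : 0 <= 2 * K / r ^+ 2 * F v by rewrite mulr_ge0.
rewrite mulrDl.
have [Fr|rF] := leP (F v) (r ^+ 2).
  apply: le_trans (cexp_wal_le_sqrt c t k m v l c0 mt l0) _.
  rewrite -/F -/f -/(E v).
  have sr : Num.sqrt (F v) <= r.
    by rewrite -[leRHS](ger0_norm (ltW r0)) -sqrtr_sqr ler_sqrt // exprn_ge0 // ltW.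
  have : l * (Num.sqrt (F v) * (Num.sqrt (F v) - E v))
         <= l * (r * (Num.sqrt (F v) - E v)).
    by rewrite ler_pM2l // ler_wpM2r // subr_ge0.
  by rewrite -[l * r * _]mulrA; lra.
apply: le_trans (cexp_wal_le_cellinf c t k m v c0 mt) _; rewrite -/mut.
have musK : mus v <= K.
  apply: le_trans (fK v); rewrite -(cexp_psum c s (t + k - s)).
  rewrite (subnKC (leq_trans st (leq_addr k t))).
  by apply: cellinf_le_cexp => v'; exact: c0.
have : 2 * K <= 2 * K / r ^+ 2 * F v.
  rewrite -mulrA ler_peMr ?mulr_ge0 // mulrC ler_pdivlMr ?exprn_gt0 //.
  by rewrite mul1r ltW.
by lra.
Qed.

Lemma coef_small {R : realType} (c : nat -> R) (e : R) :
  positive_psums c -> 0 < e -> exists n0, forall n, (n0 <= n)%N -> `|c n| <= e.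
Proof.
move=> c0 e0.
have C0 : 0 <= c 0%N by rewrite -(cexp_psum_mean c 0 w0) /=; exact: c0.
have e80 : 0 < e / 8 by rewrite divr_gt0.
have [s hs] := double_stable (mean_cellinf c) (c 0%N) _ e80
  (fun t a => mean_cellinf_ge0 c t a c0) (fun t => mean_cellinf_diag c t c0)
  (fun s t a => mean_cellinf_mono c s t a c0)
  (fun t a b => mean_cellinf_anti c t a b c0).
pose K := \sum_(0 <= n < 2 ^ s) `|c n|.
have K0 : 0 <= K by rewrite sumr_ge0.
have fK w : psum c (2 ^ s) w <= K.
  by apply: ler_sum => i _; rewrite (le_trans (ler_norm _)) // normrM normr_wal mulr1.
(* [l] and [r] make each of the two terms with factor [c 0] at most [e / 4];
   adding 1 keeps them positive and gives [r <= r ^+ 2]. *)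
pose l := 1 + 8 * c 0%N / e.
pose r := 1 + 8 * K * c 0%N / e.
have l1 : 1 <= l by rewrite /l lerDl divr_ge0 ?mulr_ge0 // ltW.
have r1 : 1 <= r by rewrite /r lerDl divr_ge0 ?mulr_ge0 // ltW.
have l0 : 0 < l by exact: lt_le_trans l1.
have r0 : 0 < r by exact: lt_le_trans r1.
have lr0 : 0 < l * r by rewrite mulr_gt0.
have d0 : 0 < e / 4 / (l * r) by rewrite !divr_gt0.
have [t0 ht0] := antitone_stable (mean_sqrt c) _ d0 (mean_sqrt_ge0 c)
  (fun t u => mean_sqrt_anti c t u c0).
pose t := maxn s t0.
have [a0 ha0] := hs t.
exists (2 ^ maxn a0 t)%N => n hn.
have n0 : (0 < n)%N by rewrite (leq_trans _ hn) // expn_gt0.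
have /andP[an na] := trunc_log_bounds (isT : (1 < 2)%N) n0.
set a := trunc_log 2 n in an na.
have : (maxn a0 t <= a)%N by rewrite -ltnS -(@ltn_exp2l 2) // (leq_ltn_trans hn).
rewrite geq_max => /andP[a0a ta].
have st : (s <= t)%N by rewrite leq_maxl.
have t0t : (t0 <= t)%N by rewrite leq_maxr.
have mt : (n - 2 ^ a < 2 ^ (t + (a - t)))%N.
  by move: na; rewrite subnKC // expnS; lia.
have := coef_le c s t (a - t) (n - 2 ^ a) K l r c0 st mt l0 r0 K0 fK.
rewrite subnKC // subnKC // => /le_trans; apply.
have h1 := ha0 a st a0a.
have h2 := ht0 t (t + (a - t).+1)%N t0t.
have h3 : l * r * (mean_sqrt c t - mean_sqrt c (t + (a - t).+1)) <= e / 4.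
  by rewrite mulrC -ler_pdivlMr //; lra.
have h4 : 2 / l * c 0%N <= e / 4.
  rewrite mulrAC ler_pdivrMr // /l mulrDr mulr1.
  have -> : e / 4 * (8 * c 0%N / e) = 2 * c 0%N by field; rewrite gt_eqF.
  by lra.
have h5 : 2 * K / r ^+ 2 * c 0%N <= e / 4.
  rewrite mulrAC ler_pdivrMr ?exprn_gt0 //.
  apply: (@le_trans _ _ (e / 4 * r)); last first.
    by rewrite ler_pM2l ?divr_gt0 // expr2 ler_peMr // ltW.
  rewrite /r mulrDr mulr1.
  have -> : e / 4 * (8 * K * c 0%N / e) = 2 * K * c 0%N by field; rewrite gt_eqF.
  by lra.
by rewrite [X in _ + X + _]mulrDl; clearbody l r; lra.
Qed.

Theorem mainTheorem1 (R : realType) (c : nat -> R)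
    (partial_sums_ge0 : forall (N : nat) (x : nat -> R), dyadic_group R x ->
       0 <= \sum_(0 <= n < N.+1) c n * walsh n x) :
  c n @[n --> \oo] --> (0 : R).
Proof.
have c0 : positive_psums c.
  case=> [|N] w; first by rewrite /psum big_geq.
  by apply: partial_sums_ge0 => i; rewrite /rad; case: (w i); [left|right].
apply/cvgr0Pnorm_le => e e0.
have [n0 hn0] := coef_small c e c0 e0.
by exists n0 => // n; exact: hn0.
Qed.
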